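(* Let $n\ge 2$ and let $\mathcal{D}\subseteq\binom{[n]}{2}$ be such that $\mathcal{D}^c$ is a matroid. Then the set $\mathrm{Pos}(\mathcal{D})$ obtained by applying to $\mathcal{D}$ the algorithm described in the context contains $\mathrm{MPos}(\mathcal{D})$, the set of all inclusion-maximal positroids contained in $\mathcal{D}^c$.
   Context: $[n]=\{1,\dots,n\}$ is cyclically ordered, $\binom{[n]}{2}$ is the set of 2-element subsets of $[n]$, and complements $(\cdot)^c$ are taken in $\binom{[n]}{2}$. A matroid here is a nonempty collection $\mathcal{B}\subseteq\binom{[n]}{2}$ (the bases) satisfying: for all $B_1,B_2\in\mathcal{B}$ and $b_1\in B_1\setminus B_2$ there is $b_2\in B_2\setminus B_1$ with $(B_1\setminus\{b_1\})\cup\{b_2\}\in\mathcal{B}$. A collection $\mathcal{I}\subseteq\binom{[n]}{2}$ is a positroid if there is a real $2\times n$ matrix $A$ such that, for $I=\{i<j\}$, the minor $\det A[I]$ on columns $i,j$ (in this order) is $>0$ if $I\in\mathcal{I}$ and $=0$ otherwise. $\mathrm{MPos}(\mathcal{D})$ is the set of positroids $\mathcal{M}\subseteq\mathcal{D}^c$ such that no positroid $\mathcal{M}'$ satisfies $\mathcal{M}\subsetneq\mathcal{M}'\subseteq\mathcal{D}^c$. Graphs. For $\mathcal{F}\subseteq\binom{[n]}{2}$, put $T_{\mathcal{F}}=\{i\in[n] : \{i,j\}\in\mathcal{F}\text{ for all }j\in[n]\setminus\{i\}\}$, and let $G_{\mathcal{F}}$ be the simple graph with vertex set $[n]\setminus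 T_{\mathcal{F}}$ and edge set $\{\{i,j\}\in\mathcal{F} : i,j\notin T_{\mathcal{F}}\}$. For $T\subseteq[n]$, $P_{n,T}$ is the polygon (cycle graph) with vertex set $[n]\setminus T$, edges joining cyclically consecutive elements of $[n]\setminus T$. For a connected component $C$ of $G_{\mathcal{F}}$, $P_{n,T_{\mathcal{F}}}\setminus C$ is the graph obtained from $P_{n,T_{\mathcal{F}}}$ by deleting the vertices of $C$, and $C|_{P_{n,T_{\mathcal{F}}}}$ is the subgraph of $P_{n,T_{\mathcal{F}}}$ induced on $V(C)$. The empty graph is regarded as connected. If $P_{n,T_{\mathcal{F}}}\setminus C$ is disconnected, it has the same number $k\ge 2$ of connected components as $C|_{P_{n,T_{\mathcal{F}}}}$; write these components as $D_1,\dots,D_k$ and $F_1,\dots,F_k$ respectively. Operations. For such $C$ and a component $D$ of $P_{n,T_{\mathcal{F}}}\setminus C$, $\mathcal{F}\cup(C\cdot D)$ denotes the set obtained from $\mathcal{F}$ by adding all pairs $\{i,j\}$ with $i\in V(C)$, $j\in V(D)$, and then adding all pairs $\{i,k\}$ of distinct vertices of $[n]\setminus T_{\mathcal{F}}$ which lie in the same connected component of the resulting graph on $[n]\setminus T_{\mathcal{F}}$. For a component $F$ of $C|_{P_{n,T_{\mathcal{F}}}}$, $\mathcal{F}+F=\mathcal{F}\cup\{\{i,j\} : i\in V(F),\ j\in[n]\setminus\{i\}\}$. Algorithm. Start with the worklist $\mathcal{G}=\{\mathcal{D}\}$ and $\mathrm{Pos}(\mathcal{D})=\emptyset$. While $\mathcal{G}\neq\emptyset$,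 process each $\mathcal{F}\in\mathcal{G}$ as follows. Let $C_1,\dots,C_m$ be the connected components of $G_{\mathcal{F}}$. If $P_{n,T_{\mathcal{F}}}\setminus C_i$ is connected for all $i\in[m]$, add $\mathcal{F}^c$ to $\mathrm{Pos}(\mathcal{D})$ and remove $\mathcal{F}$ from $\mathcal{G}$. Otherwise, for every $j\in[m]$ such that $P_{n,T_{\mathcal{F}}}\setminus C_j$ is disconnected, with components $D^j_1,\dots,D^j_{k_j}$, and with $F^j_1,\dots,F^j_{k_j}$ the components of $C_j|_{P_{n,T_{\mathcal{F}}}}$, add to $\mathcal{G}$ all the sets $\mathcal{F}\cup(C_j\cdot D^j_1),\dots,\mathcal{F}\cup(C_j\cdot D^j_{k_j}),\ \mathcal{F}+F^j_1,\dots,\mathcal{F}+F^j_{k_j}$; then remove $\mathcal{F}$ from $\mathcal{G}$. When $\mathcal{G}=\emptyset$, return $\mathrm{Pos}(\mathcal{D})$. *)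

(* Defs.v *)
From HB Require Import structures.
From mathcomp Require Import all_boot all_order all_algebra.
From mathcomp Require Import reals.

Set Implicit Arguments.
Unset Strict Implicit.
Unset Printing Implicit Defensive.

(* The set [n] = {1, ..., n} is represented by 'I_n = {0, ..., n-1}. *)

Definition pairs (n : nat) : {set {set 'I_n}} :=
  [set B : {set 'I_n} | #|B| == 2].

Definition compl (n : nat) (F : {set {set 'I_n}}) : {set {set 'I_n}} :=
  pairs n :\: F.

Definition matroid (n : nat) (B : {set {set 'I_n}}) : Prop :=
  [/\ B \subset pairs n, B != set0 &
   forall B1 B2 : {set 'I_n}, B1 \in B -> B2 \in B ->
   forall b1, b1 \in B1 :\: B2 ->
   exists2 b2, b2 \in B2 :\: B1 & b2 |: (B1 :\ b1) \in B].

Definition minor (R : realType) (n : nat) (A : 'M[R]_(2, n)) (i j : 'I_n) : R :=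
  (\det (colsub (tnth [tuple i; j]) A))%R.

Definition positroid (R : realType) (n : nat) (I : {set {set 'I_n}}) : Prop :=
  I \subset pairs n /\
  exists A : 'M[R]_(2, n), forall i j : 'I_n, i < j ->
    ([set i; j] \in I -> (0 < minor A i j)%R) /\
    ([set i; j] \notin I -> minor A i j = 0%R).

Definition MPos (R : realType) (n : nat) (D M : {set {set 'I_n}}) : Prop :=
  [/\ positroid R M, M \subset compl D &
   ~ exists M' : {set {set 'I_n}},
       [/\ positroid R M', M \proper M' & M' \subset compl D]].

(* A graph whose vertices lie in 'I_n. Only the restriction of adj to verts
   is meaningful; two vertices are joined when they are adj-related. *)
Record graph (n : nat) := Graph { verts : {set 'I_n}; adj : rel 'I_n }.

Definition edge (n : nat) (G : graph n) : rel 'I_n :=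
  [rel i j | [&& i \in verts G, j \in verts G & adj G i j]].

(* Connected components, as vertex sets; [edge G] is symmetric for all the
   graphs below, so that [connect (edge G)] is an equivalence relation. *)
Definition components (n : nat) (G : graph n) : {set {set 'I_n}} :=
  equivalence_partition (connect (edge G)) (verts G).

(* The empty graph is connected. *)
Definition connected (n : nat) (G : graph n) : bool := #|components G| <= 1.

Definition induced (n : nat) (G : graph n) (W : {set 'I_n}) : graph n :=
  Graph (verts G :&: W) (adj G).

Definition delete (n : nat) (G : graph n) (W : {set 'I_n}) : graph n :=
  Graph (verts G :\: W) (adj G).

Definition T_ (n : nat) (F : {set {set 'I_n}}) : {set 'I_n} :=
  [set i | [forall j, (j != i) ==> ([set i; j] \in F)]].

(* The simple graph with vertex set V whose edges are the members of E
   contained in V. *)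
Definition graph_on (n : nat) (V : {set 'I_n}) (E : {set {set 'I_n}}) : graph n :=
  Graph V [rel i j | (i != j) && ([set i; j] \in E)].

Definition G_ (n : nat) (F : {set {set 'I_n}}) : graph n :=
  graph_on (~: T_ F) F.

(* [enum V] lists V in increasing order, so that [next (enum V) i] is the
   element of V following i in the cyclic order. *)
Definition polygon (n : nat) (T : {set 'I_n}) : graph n :=
  let V := ~: T in
  Graph V [rel i j | (i != j) &&
                     ((j == next (enum V) i) || (i == next (enum V) j))].

Definition P_ (n : nat) (F : {set {set 'I_n}}) : graph n := polygon (T_ F).

Definition join_component (n : nat) (F : {set {set 'I_n}}) (C D : {set 'I_n}) :
    {set {set 'I_n}} :=
  let F' := F :|: [set [set i; j] | i in C, j in D] in
  F' :|: [set [set i; k] | i in ~: T_ F, k in ~: T_ F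
            & (i != k) && connect (edge (graph_on (~: T_ F) F')) i k].

Definition add_loops (n : nat) (F : {set {set 'I_n}}) (X : {set 'I_n}) :
    {set {set 'I_n}} :=
  F :|: [set [set i; j] | i in X, j in [set~ i]].

Definition splitting (n : nat) (F : {set {set 'I_n}}) : {set {set 'I_n}} :=
  [set C in components (G_ F) | ~~ connected (delete (P_ F) C)].

Definition successors (n : nat) (F : {set {set 'I_n}}) : {set {set {set 'I_n}}} :=
  \bigcup_(C in splitting F)
    ([set join_component F C D | D in components (delete (P_ F) C)] :|:
     [set add_loops F X | X in components (induced (P_ F) C)]).

(* A state is a pair (worklist, sets returned so far). One pass processes
   every F in the worklist. *)
Definition state (n : nat) : Type :=
  ({set {set {set 'I_n}}} * {set {set {set 'I_n}}})%type.

Definition pass (n : nat) (s : state n) : state n :=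
  (\bigcup_(F in s.1) (if splitting F == set0 then set0 else successors F),
   s.2 :|: [set compl F | F in s.1 & splitting F == set0]).

Definition init (n : nat) (D : {set {set 'I_n}}) : state n := ([set D], set0).

Lemma edge_graph_on_sym n V E : symmetric (edge (@graph_on n V E)).
Proof. by move=> i j; rewrite /edge /= andbCA eq_sym setUC. Qed.

Lemma edge_polygon_sym n T : symmetric (edge (@polygon n T)).
Proof. by move=> i j; rewrite /edge /= andbCA eq_sym orbC. Qed.

Lemma componentsP n (G : graph n) C : C \in components G ->
  exists2 x, x \in verts G & C = [set y in verts G | connect (edge G) x y].
Proof. by case/imsetP=> x xV ->; exists x. Qed.

Lemma successors_proper n (F F' : {set {set 'I_n}}) :
  F' \in successors F -> F \proper F'.
Proof.
case/bigcupP=> C; rewrite inE => /andP[/componentsP[x xV CE] _].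
have xC : x \in C by rewrite CE inE xV connect0.
case/setUP=> /imsetP[W /componentsP[y yV WE] ->].
- have yW : y \in W by rewrite WE inE yV connect0.
  move: yV; rewrite inE => /andP[yC yV]; have yC' := yC.
  apply/properP; rewrite /join_component /=; split; first by rewrite -setUA subsetUl.
  exists [set x; y].
    by apply/setUP; left; apply/setUP; right; apply/imset2P; exists x y.
  apply: contra yC => xyF; rewrite CE inE yV; apply: connect1.
  apply/and3P; split=> //=; rewrite xyF andbT.
  by apply: contraNneq yC' => <-.
- have yW : y \in W by rewrite WE inE yV connect0.
  apply/properP; split; first exact: subsetUl.
  move: yV; rewrite !inE => /andP[/forallPn[j]].
  rewrite negb_imply => /andP[jy yjF] _.
  exists [set y; j] => //.
  by apply/setUP; right; apply/imset2P; exists y j; rewrite ?inE.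
Qed.

Lemma pass_card n (D : {set {set 'I_n}}) k F :
  F \in (iter k (@pass n) (init D)).1 -> k <= #|F|.
Proof.
elim: k F => // k IHk F /= /bigcupP[F0 /IHk kF0].
case: ifP => _; first by rewrite inE.
by move/successors_proper/proper_card; apply: leq_ltn_trans.
Qed.

Lemma pass_terminates n (D : {set {set 'I_n}}) :
  exists k, (iter k (@pass n) (init D)).1 == set0.
Proof.
exists #|{set 'I_n}|.+1; apply: contraT => /set0Pn[F /pass_card].
by rewrite ltnNge max_card.
Qed.

(* The second component of the state when the worklist first becomes empty. *)
Definition Pos (n : nat) (D : {set {set 'I_n}}) : {set {set {set 'I_n}}} :=
  (iter (ex_minn (pass_terminates D)) (@pass n) (init D)).2.

(* Main.v *)
(* Let M be a positroid contained in the complement of F, realised by vectors in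
   the plane.  Suppose a parallel class C of F splits the polygon, and that each
   polygon piece of every splitting class contains a nonzero vector (otherwise
   some piece consists of loops of M and M avoids F + piece).  If two components
   of P \ C contained elements d1, d2 off the line of C, then C would have nonzero
   vectors a, b on both arcs between d1 and d2, and the Pluecker relation
   [a d1][b d2] = [a d2][b d1] would contradict the signs of the minors.  So all
   vectors of some component D of P \ C lie on the line of C.  A class E meeting
   D either lies inside D or is itself splitting, with a piece inside D; that
   piece contains a nonzero vector, so E lies on the line of C as well, and M
   avoids F + C.D together with its transitive closure.  Hence some set produced
   by the algorithm from F still has M in its complement.
   If no class splits the polygon, every class is a cyclic interval, and the
   vectors (1, m), with m the minimum of the class, realise the complement of F,
   up to sign for the class which wraps around; maximality of M forces equality. *)
Require Import Defs.
From mathcomp Require Import all_boot all_order all_algebra.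
From mathcomp Require Import reals.
From mathcomp Require Import zify ring lra.

Set Implicit Arguments.
Unset Strict Implicit.
Unset Printing Implicit Defensive.

Import Order.TTheory GRing.Theory Num.Theory.

(** * Connected components of a graph *)

Section Components.
Variables (n : nat) (G : graph n).
Hypothesis edge_sym : symmetric (edge G).

Lemma component_eq C x :
  C \in components G -> x \in C -> C = [set y in verts G | connect (edge G) x y].
Proof.
case/componentsP=> x0 x0V -> {C}; rewrite inE => /andP[_ x0x].
by apply/setP=> y; rewrite !inE (same_connect (sym_connect_sym edge_sym) x0x).
Qed.

Lemma component_connect C x y :
  C \in components G -> x \in C -> y \in C -> connect (edge G) x y.
Proof. by move=> CG xC; rewrite (component_eq CG xC) inE => /andP[]. Qed.

Lemma component_sub C : C \in components G -> C \subset verts G.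
Proof.
by case/componentsP=> x _ ->; apply/subsetP=> y; rewrite inE => /andP[].
Qed.

Lemma component_neq0 C : C \in components G -> exists x, x \in C.
Proof. by case/componentsP=> x xV ->; exists x; rewrite inE xV connect0. Qed.

Lemma component_of x : x \in verts G ->
  exists2 C, C \in components G & x \in C.
Proof.
move=> xV; exists [set y in verts G | connect (edge G) x y].
  by apply/imsetP; exists x.
by rewrite inE xV connect0.
Qed.

Lemma connected_connect x y : connected G ->
  x \in verts G -> y \in verts G -> connect (edge G) x y.
Proof.
move=> /card_le1_eqP Gconn /component_of[C CG xC] /component_of[C' C'G yC'].
by apply: (component_connect CG xC); rewrite -(Gconn _ _ CG C'G).
Qed.

Lemma connect_verts x y : x \in verts G -> connect (edge G) x y -> y \in verts G.
Proof.
move=> xV xy; suff clV: closed (edge G) (mem (verts G)).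
  by rewrite -(closed_connect clV xy).
by move=> i j /and3P[-> ->].
Qed.

End Components.

(** * Cyclic succession and arcs in the polygon *)

Section Polygon.
Variables (n : nat) (T : {set 'I_n}).
Let V := ~: T.

Lemma sorted_enum_set (A : {set 'I_n}) : sorted ltn (map val (enum A)).
Proof.
have -> : map val (enum A) = filter (mem (map val (enum A))) (map val (enum 'I_n)).
  rewrite filter_map; congr map; rewrite [enum 'I_n]enumT; apply: eq_filter => i.
  by rewrite /= (mem_map val_inj) mem_enum.
by rewrite val_enum_ord; apply: (sorted_filter ltn_trans); apply: iota_ltn_sorted.
Qed.

(** The last alternative is the wrap-around: [i] is the largest element of [V] and [j] the smallest.
    It includes a one-element [V], where [j = i]. *)
Lemma next_enumP i : i \in V -> let j := next (enum V) i in
  j \in V /\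
  ((i < j /\ forall k, k \in V -> i < k -> j <= k)
   \/ (forall k, k \in V -> k <= i /\ j <= k)).
Proof.
move=> iV j; have ie : i \in enum V by rewrite mem_enum.
have jV : j \in V by rewrite -mem_enum mem_next.
split=> //; move: (sorted_enum_set V) ie.
have kV k : k \in V -> k \in enum V by rewrite mem_enum.
rewrite {}/j in jV *; rewrite next_nth.
move: kV; case: (enum V) => [//|y p] kV sp ie; rewrite ie.
set s := y :: p in kV sp ie *.
have nth_lt a b : a < b < size s -> (nth y s a < nth y s b).
  move=> /andP[ab bs]; rewrite -!(nth_map y 0 val) //; last exact: ltn_trans ab bs.
  by apply: (sorted_ltn_nth ltn_trans 0 sp) => //; rewrite ?inE size_map //; apply: ltn_trans ab bs.
have idx := index_mem i s; rewrite ie in idx; have nidx := nth_index y ie.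
change (nth y p (index i s)) with (nth y s (index i s).+1).
case: (ltnP (index i s).+1 (size s)) => [lt|ge].
- have := nth_lt (index i s) (index i s).+1; rewrite nidx ltnSn lt => /(_ isT) ij.
  left; split=> //.
  move=> k /kV ks ik; have nk := nth_index y ks; have := index_mem k s; rewrite ks => ksz.
  rewrite leqNgt; apply/negP => kj.
  have ik' : index i s < index k s.
    rewrite ltnNge leq_eqVlt; apply/negP => /orP[/eqP e|l].
      by move: ik; rewrite -nk e nidx ltnn.
    by have := nth_lt (index k s) (index i s); rewrite l idx nk nidx => /(_ isT); lia.
  move: kj; rewrite -nk ltnNge leq_eqVlt => /negP; apply.
  move: ik'; rewrite leq_eqVlt => /orP[/eqP->|l]; first by rewrite eqxx.
  by rewrite nth_lt ?orbT // l.
(* Past the end of the list the default of [nth] is its head [y], which is exactly the wrap-around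
   of [next]. *)
- right=> k /kV ks; rewrite (nth_default _ ge).
  have nk := nth_index y ks; have := index_mem k s; rewrite ks => ksz.
  split.
    rewrite leqNgt; apply/negP => lt.
    have : index k s <= index i s by rewrite -ltnS; apply: leq_trans ksz ge.
    rewrite leq_eqVlt => /orP[/eqP e|l]; first by move: lt; rewrite -nk e nidx ltnn.
    by have := nth_lt (index k s) (index i s); rewrite l idx nk nidx => /(_ isT); lia.
  case: (posnP (index k s)) => [e|pos]; first by rewrite -nk e.
  by have := nth_lt 0 (index k s); rewrite pos ksz nk => /(_ isT)/ltnW.
Qed.

Variable W : {set 'I_n}.
Hypothesis WV : W \subset V.
(** Both [delete (P_ F) C] and [induced (P_ F) C] have this form; adjacency remains that of the
    whole polygon. *)
Let e := edge (Graph W (adj (polygon T))).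

Lemma edge_subpolygon_sym : symmetric e.
Proof. by move=> i j; rewrite /e /edge /= andbCA eq_sym orbC. Qed.

(** A step to the cyclic successor never jumps over an element of [V], so a path inside [W] cannot
    cross [x] or [y]; the wrap-around step starts and ends outside the interval. *)
Lemma connect_between x y a b : x \in V :\: W -> y \in V :\: W -> x < y ->
  connect e a b -> (x < a < y) = (x < b < y).
Proof.
move=> xV yV xy ab.
suff cl : closed e [pred k : 'I_n | x < k < y] by have := closed_connect cl ab; rewrite !inE.
have step i j : i \in W -> j \in W -> j = next (enum V) i -> (x < i < y) = (x < j < y).
  move=> iW jW jE; have := next_enumP (subsetP WV _ iW); rewrite /= -jE.
  move: xV yV; rewrite !in_setD => /andP[xW xV] /andP[yW yV].
  have ne k z : k \in W -> z \notin W -> nat_of_ord k <> z.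
    by move=> kW zW /val_inj kz; rewrite -kz kW in zW.
  move: (ne _ _ iW xW) (ne _ _ iW yW) (ne _ _ jW xW) (ne _ _ jW yW) => n1 n2 n3 n4.
  case=> jV [[ij nx]|nx]; have := nx _ xV; have := nx _ yV; lia.
move=> i j /and3P[/= iW jW /andP[_ /orP[/eqP|/eqP]]] nx.
  exact: step iW jW nx.
by rewrite !inE (step j i).
Qed.

Lemma succ_in i : i \in W -> exists j,
  [/\ j \in V, j \in W -> connect e i j &
   (i < j /\ forall k, k \in V -> i < k -> j <= k)
   \/ (forall k, k \in V -> k <= i /\ j <= k)].
Proof.
move=> iW; have [jV nx] := next_enumP (subsetP WV _ iW).
exists (next (enum V) i); split=> // jW.
have [<-|ne] := eqVneq i (next (enum V) i); first exact: connect0.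
by apply: connect1; rewrite /e /edge /= iW jW ne eqxx.
Qed.

Lemma connect_arc x y : x \in W -> y \in W -> x <= y ->
  (forall k, k \in V -> x < k < y -> k \in W) -> connect e x y.
Proof.
move: {2}(y - x) (leqnn (y - x)) => m; elim: m x => [|m IH] x yx xW yW xy arc.
  by have -> : x = y; [apply: val_inj => /=; lia | apply: connect0].
move: xy; rewrite leq_eqVlt => /orP[/eqP/val_inj->|xy]; first exact: connect0.
have [j [jV xj' [[xj nx]|nx]]] := succ_in xW; last first.
  by have := nx _ (subsetP WV _ yW); lia.
have jy := nx _ (subsetP WV _ yW) xy.
have jW : j \in W.
  move: jy; rewrite leq_eqVlt => /orP[/eqP/val_inj->//|jy].
  by apply: arc => //; rewrite xj.
apply: connect_trans (xj' jW) _; apply: IH => //; first by lia.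
by move=> k kV kxy; apply: arc => //; lia.
Qed.

(** The walk climbs from [y] to the last element of [V], wraps to the first one and reaches [x] by
    [connect_arc]. *)
Lemma connect_outer_arc x y : x \in W -> y \in W -> x <= y ->
  (forall k, k \in V -> (k < x) || (y < k) -> k \in W) -> connect e y x.
Proof.
move: {2}(n - y) (leqnn (n - y)) => m; elim: m y => [|m IH] y yn xW yW xy arc.
  by have := ltn_ord y; lia.
have [j [jV yj' [[yj nx]|nx]]] := succ_in yW.
  have jW : j \in W by apply: arc => //; rewrite yj orbT.
  apply: connect_trans (yj' jW) _; apply: IH => //; try lia.
  by move=> k kV kxy; apply: arc => //; lia.
have [_ jx] := nx _ (subsetP WV _ xW).
have jW : j \in W.
  move: jx; rewrite leq_eqVlt => /orP[/eqP/val_inj->//|jx].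
  by apply: arc => //; rewrite jx.
apply: connect_trans (yj' jW) _; apply: connect_arc => //.
by move=> k kV kjx; apply: arc => //; lia.
Qed.

(** If either of the two arcs between [x] and [y] stayed in [W], it would connect them; hence each
    arc leaves [W] somewhere. *)
Lemma disconnect_separated x y : x \in W -> y \in W -> x < y -> ~~ connect e x y ->
  exists2 c, c \in V :\: W & exists2 c', c' \in V :\: W &
    (x < c < y) && ~~ (x < c' < y).
Proof.
move=> xW yW xy nxy.
have /exists_inP[c cV cxy] : [exists c in V :\: W, x < c < y].
  apply: contraR nxy => /exists_inPn no; apply: connect_arc => //; first exact: ltnW.
  by move=> k kV kxy; apply: contraT => kW; have := no k; rewrite in_setD kW kV kxy => /(_ isT).
have /exists_inP[c' c'V c'xy] : [exists c in V :\: W, (c < x) || (y < c)].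
  apply: contraR nxy => /exists_inPn no.
  rewrite (sym_connect_sym edge_subpolygon_sym); apply: connect_outer_arc => //; first exact: ltnW.
  by move=> k kV kxy; apply: contraT => kW; have := no k; rewrite in_setD kW kV kxy => /(_ isT).
by exists c => //; exists c' => //; rewrite cxy; lia.
Qed.

End Polygon.

(** * Signs and vanishing of the minors of a matrix with two rows *)

Section Plucker.
Local Open Scope ring_scope.
Variables (R : realType) (n : nat) (u v : 'I_n -> R).

Definition plucker (i j : 'I_n) : R := u i * v j - v i * u j.
Definition nonloop (i : 'I_n) : bool := (u i != 0) || (v i != 0).

Lemma pluckerC i j : plucker j i = - plucker i j.
Proof. by rewrite /plucker; ring. Qed.

Lemma plucker_nonloop i j : plucker i j != 0 -> nonloop i.
Proof.
rewrite /nonloop /plucker; have [->|//] := eqVneq (u i) 0; have [->|//] := eqVneq (v i) 0.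
by rewrite !mul0r subrr eqxx.
Qed.

(** Multiplied by either coordinate of [x], [plucker a b] is a combination of [plucker x a] and
    [plucker x b]; some coordinate of [x] can be cancelled. *)
Lemma plucker_trans x a b : nonloop x ->
  plucker x a = 0 -> plucker x b = 0 -> plucker a b = 0.
Proof.
move=> x0 xa xb; case/orP: x0 => x0; apply: (mulfI x0); rewrite mulr0.
  have -> : u x * plucker a b = u a * plucker x b - u b * plucker x a.
    by rewrite /plucker; ring.
  by rewrite xa xb !mulr0 subrr.
have -> : v x * plucker a b = v a * plucker x b - v b * plucker x a.
  by rewrite /plucker; ring.
by rewrite xa xb !mulr0 subrr.
Qed.

(** With [plucker a b = 0], the three-term relation becomes [rel]. Since [a] and [b] lie on
    different arcs between [x] and [y], its two sides have opposite weak signs, so both vanish. *)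
Lemma plucker_alternating (x y a b : 'I_n) :
  (forall i j : 'I_n, (i < j)%N -> 0 <= plucker i j) ->
  (x < y)%N -> (x < a < y)%N -> ((b < x) || (y < b))%N ->
  nonloop a -> nonloop b -> plucker a b = 0 ->
  plucker a x = 0 \/ plucker a y = 0.
Proof.
move=> pos xy /andP[xa ay] out a0 b0 ab.
have rel : plucker a x * plucker b y = plucker a y * plucker b x.
  have : plucker a b * plucker x y - plucker a x * plucker b y
         + plucker a y * plucker b x = 0 by rewrite /plucker; ring.
  by rewrite ab; lra.
have ax : plucker a x <= 0 by rewrite pluckerC oppr_le0 pos.
have ay' : 0 <= plucker a y by rewrite pos.
suff /eqP : plucker a x * plucker b y = 0.
  rewrite mulf_eq0 => /orP[/eqP|/eqP b_y]; first by left.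
  right; apply: (plucker_trans b0) => //.
  by rewrite pluckerC ab oppr0.
case/orP: out => out.
  have bx : 0 <= plucker b x by rewrite pos.
  have b_y : 0 <= plucker b y by rewrite pos // (ltn_trans out).
  by apply/eqP; rewrite eq_le; apply/andP; split; [nra | rewrite rel mulr_ge0].
have bx : plucker b x <= 0 by rewrite pluckerC oppr_le0 pos // (ltn_trans xy).
have b_y : plucker b y <= 0 by rewrite pluckerC oppr_le0 pos.
apply/eqP; rewrite eq_le; apply/andP; split; last by rewrite mulr_le0.
by rewrite rel mulr_ge0_le0.
Qed.

End Plucker.

Lemma minorE (R : realType) n (A : 'M[R]_(2, n)) i j :
  minor A i j = plucker (A ord0) (A ord_max) i j.
Proof.
rewrite /minor (expand_det_row _ ord0) !big_ord_recl big_ord0 /cofactor !det_mx11 !mxE.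
have -> : lift (lift ord0 ord0) (0%R : 'I_1) = ord0 :> 'I_2 by apply: val_inj.
have -> : lift ord0 (0%R : 'I_1) = ord_max :> 'I_2 by apply: val_inj.
rewrite !(tnth_nth i) /plucker /=; ring.
Qed.

Lemma positroid_plucker (R : realType) n (M : {set {set 'I_n}}) : positroid R M ->
  exists u v : 'I_n -> R,
    (forall i j : 'I_n, i < j -> (0 <= plucker u v i j)%R) /\
    (forall i j, i != j -> ([set i; j] \in M) = (plucker u v i j != 0)%R).
Proof.
case=> _ [A HA]; exists (A ord0), (A ord_max).
have lt (i j : 'I_n) : i < j ->
    ([set i; j] \in M) = (plucker (A ord0) (A ord_max) i j != 0)%R.
  move=> /HA; rewrite minorE; case: ([set i; j] \in M) => -[pos zero].
    by rewrite gt_eqF // pos.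
  by rewrite zero // eqxx.
split=> i j.
  move=> ij; have [pos zero] := HA i j ij; rewrite -minorE.
  by have [/pos/ltW|/zero->] := boolP ([set i; j] \in M).
rewrite neq_ltn => /orP[|ji]; first exact: lt.
by rewrite setUC lt // pluckerC oppr_eq0.
Qed.

Lemma plucker_positroid (R : realType) n (M : {set {set 'I_n}}) (u v : 'I_n -> R) :
  M \subset pairs n ->
  (forall i j : 'I_n, i < j -> [set i; j] \in M -> (0 < plucker u v i j)%R) ->
  (forall i j : 'I_n, i < j -> [set i; j] \notin M -> plucker u v i j = 0%R) ->
  positroid R M.
Proof.
move=> Mp pos zero; split=> //.
exists (\matrix_(i < 2, j < n) if i == ord0 then u j else v j)%R => i j ij.
suff -> : minor (\matrix_(i < 2, j < n) if i == ord0 then u j else v j)%R i j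
          = plucker u v i j by split; [apply: pos | apply: zero].
by rewrite minorE /plucker !mxE.
Qed.

Lemma in_complP n (F M : {set {set 'I_n}}) : M \subset pairs n ->
  reflect (forall B, B \in F -> B \notin M) (M \subset compl F).
Proof.
move=> Mp; rewrite /compl subsetD Mp /= disjoint_sym disjoint_subset.
exact: subsetP.
Qed.

Lemma not_compl n (F M : {set {set 'I_n}}) : M \subset pairs n ->
  ~~ (M \subset compl F) -> exists2 B, B \in F & B \in M.
Proof.
move=> Mp /subsetPn[B BM]; rewrite in_setD (subsetP Mp _ BM) andbT negbK => BF.
by exists B.
Qed.

Lemma not_between (b x y : nat) : b <> x -> b <> y -> ~~ (x < b < y) -> (b < x) || (y < b).
Proof. lia. Qed.

(* Parallelism is transitive on the non-loops of the complement of F. *)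
Definition closed_pairs n (F : {set {set 'I_n}}) : Prop :=
  forall i j, i != j -> connect (edge (G_ F)) i j -> [set i; j] \in F.

(** * A step of the algorithm at a splitting set loses no positroid *)

Section Successor.
Variables (R : realType) (n : nat) (F M : {set {set 'I_n}}).
Hypothesis F_closed : closed_pairs F.
Hypothesis M_positroid : positroid R M.
Hypothesis MF : M \subset compl F.
Hypothesis F_splitting : splitting F != set0.

Lemma positroid_successor : exists2 F', F' \in successors F & M \subset compl F'.
Proof.
(* By contradiction: [no] says that [M] contains a pair of every successor of [F]. *)
apply/exists_inP; apply: contraT => /exists_inPn no.
have [u [v [pos ME]]] := positroid_plucker M_positroid.
have Mp : M \subset pairs n by case: M_positroid.
pose p := plucker u v; pose nl := nonloop u v.
have pC i j : p i j = 0%R -> p j i = 0%R by rewrite /p => ij; rewrite pluckerC ij oppr0.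
have p_diag i : p i i = 0%R by rewrite /p /plucker mulrC subrr.
have F0 i j : [set i; j] \in F -> p i j = 0%R.
  have [-> _|ij ijF] := eqVneq i j; first exact: p_diag.
  by move/in_complP: MF => /(_ Mp _ ijF); rewrite ME // negbK => /eqP.
have GF_sym : symmetric (edge (G_ F)) by apply: edge_graph_on_sym.
have conn0 i j : connect (edge (G_ F)) i j -> p i j = 0%R.
  have [-> _|ij ijF] := eqVneq i j; first exact: p_diag.
  by apply: F0; apply: F_closed.
have class0 C i j : C \in components (G_ F) -> i \in C -> j \in C -> p i j = 0%R.
  by move=> CF iC jC; apply: conn0; apply: component_connect CF iC jC.
(* [M] avoids [F] but meets [add_loops F X], so some base has an element in [X]; that element is
   nonzero. *)
have piece_nl C X : C \in splitting F -> X \in components (induced (P_ F) C) ->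
    exists2 x, x \in X & nl x.
  move=> CF XC; have /no /(not_compl Mp)[B BF BM] : add_loops F X \in successors F.
    by apply/bigcupP; exists C => //; apply/setUP; right; apply/imsetP; exists X.
  have {BF}/imset2P[i j iX] : B \in [set [set i; j] | i in X, j in [set~ i]].
    case/setUP: BF => // BF; have /subsetP/(_ B BM) := MF.
    by rewrite in_setD BF.
  rewrite !inE eq_sym => ij BE; exists i => //; apply: (@plucker_nonloop _ _ u v i j).
  by rewrite -ME // -BE.
have C_in C : C \in splitting F -> [/\ C \in components (G_ F), C \subset ~: T_ F
    & ~~ connected (delete (P_ F) C)].
  rewrite inE => /andP[CF ?]; split=> //; exact: (component_sub CF).
(* Moving inside its polygon piece, [c] can be replaced by a nonzero vector of [C] on the same
   arc. *)
have nl_between C (x y c : 'I_n) : C \in splitting F -> c \in C ->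
    x \in ~: T_ F :\: C -> y \in ~: T_ F :\: C -> x < y ->
    exists a, [/\ a \in C, nl a & (x < a < y) = (x < c < y)].
  move=> CS cC xV yV xy; have [CF CV _] := C_in _ CS.
  have cV : c \in verts (induced (P_ F) C) by rewrite inE (subsetP CV _ cC).
  have [X XC cX] := component_of cV.
  have [a aX nla] := piece_nl _ _ CS XC; exists a; split=> //.
    by have := subsetP (component_sub XC) _ aX; rewrite inE => /andP[].
  have sym := @edge_subpolygon_sym _ (T_ F) (~: T_ F :&: C).
  have outside z : z \in ~: T_ F :\: C -> z \in ~: T_ F :\: (~: T_ F :&: C).
    by rewrite in_setD => /andP[/negPf zC zV]; rewrite in_setD in_setI zC zV.
  apply: (connect_between (subsetIl _ C) (outside _ xV) (outside _ yV) xy).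
  exact: (component_connect sym XC aX cX).
have C_nl C : C \in splitting F -> exists2 c, c \in C & nl c.
  move=> CS; have [CF CV _] := C_in _ CS; have [c cC] := component_neq0 CF.
  have cV : c \in verts (induced (P_ F) C) by rewrite inE (subsetP CV _ cC).
  have [X XC _] := component_of cV; have [a aX nla] := piece_nl _ _ CS XC.
  by exists a => //; have := subsetP (component_sub XC) _ aX; rewrite inE => /andP[].
have D_sym C := @edge_subpolygon_sym _ (T_ F) (~: T_ F :\: C).
(* Every component of the polygon minus [C] leaves the line of [C]; otherwise [M] would avoid
   [join_component F C D]. *)
have nonpar C D : C \in splitting F -> D \in components (delete (P_ F) C) ->
    exists2 d, d \in D & forall c, c \in C -> nl c -> p c d <> 0%R.
  move=> CS DC; have [CF CV _] := C_in _ CS; have [c0 c0C nlc0] := C_nl _ CS.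
  have [/exists_inP[d dD c0d]|/exists_inPn D0] := boolP [exists d in D, p c0 d != 0%R].
    exists d => // c cC nlc cd; case/eqP: c0d.
    by apply: plucker_trans nlc _ cd; apply: class0 CF cC c0C.
  have {}D0 d : d \in D -> p c0 d = 0%R by move/D0; rewrite negbK => /eqP.
  exfalso.
  have DV d : d \in D -> d \in ~: T_ F :\: C by apply/subsetP/(component_sub DC).
  (* [S] is [C] together with all classes meeting [D]: what the join merges into one class. *)
  pose S i := (i \in C) || [exists d in D, connect (edge (G_ F)) d i].
  have S0 i : S i -> p c0 i = 0%R.
    rewrite /S; have [iC _|iC /= /exists_inP[d dD di]] := boolP (i \in C).
      exact: class0 CF c0C iC.
    have [/D0 //|iD] := boolP (i \in D).
    have dV := DV _ dD; have [dV' dC] : d \in ~: T_ F /\ d \notin C.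
      by move: dV; rewrite in_setD => /andP[].
    have iV' : i \in ~: T_ F by apply: (@connect_verts _ (G_ F) _ _ dV' di).
    have iV : i \in ~: T_ F :\: C by rewrite in_setD iC.
    have [E EF dE] := component_of (dV' : d \in verts (G_ F)).
    have iE : i \in E by rewrite (component_eq GF_sym EF dE) inE iV'.
    have CE z : z \in C -> z \notin E.
      move=> zC; apply: contra dC => zE; rewrite (component_eq GF_sym CF zC).
      by rewrite -(component_eq GF_sym EF zE).
    have ndi : ~~ connect (edge (delete (P_ F) C)) d i.
      by apply: contra iD => cdi; rewrite (component_eq (D_sym C) DC dD) inE cdi andbT.
    (* Two elements of [E] in different components of the polygon minus [C] have elements of [C] on
       both arcs between them; as [C] misses [E], the class [E] splits the polygon. *)
    have noconn (x y : 'I_n) : x \in E -> y \in E -> x \in ~: T_ F -> y \in ~: T_ F ->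
        x < y -> ~~ connect (edge (delete (P_ F) C)) x y -> ~~ connected (delete (P_ F) E).
      move=> xE yE xV yV xy nxy; apply/negP => Econn.
      have xVC : x \in ~: T_ F :\: C by rewrite in_setD xV andbT; apply: contraL xE; apply: CE.
      have yVC : y \in ~: T_ F :\: C by rewrite in_setD yV andbT; apply: contraL yE; apply: CE.
      have [c cV [c' c'V /andP[cb c'b]]] :=
        disconnect_separated (subsetDl _ _) xVC yVC xy nxy.
      have VE z : z \in ~: T_ F :\: (~: T_ F :\: C) -> z \in ~: T_ F :\: E.
        move/setDP=> [zV]; rewrite !in_setD zV !andbT negbK; exact: CE.
      have cc' := connected_connect (D_sym E) Econn (VE _ cV) (VE _ c'V).
      have := connect_between (subsetDl _ _) _ _ xy cc'; rewrite cb (negPf c'b).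
      by rewrite !in_setD xV yV xE yE => /(_ isT isT).
    have ES : E \in splitting F.
      rewrite inE EF /=; have : d != i by apply: contraNneq iD => <-.
      rewrite neq_ltn => /orP[lt|lt]; first exact: noconn lt ndi.
      by apply: noconn lt _ => //; rewrite (sym_connect_sym (D_sym C)).
    have [X XE dX] : exists2 X, X \in components (induced (P_ F) E) & d \in X.
      by apply: component_of; rewrite inE dE andbT.
    have [x xX nlx] := piece_nl _ _ ES XE.
    have xE : x \in E.
      by have := subsetP (component_sub XE) _ xX; rewrite inE => /andP[].
    (* The polygon piece of [E] through [d] avoids [C], hence stays inside [D]. *)
    have xD : x \in D.
      rewrite (component_eq (D_sym C) DC dD) inE; apply/andP; split.
        have [_ EV _] := C_in _ ES; rewrite in_setD (subsetP EV _ xE) andbT.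
        by apply: contraL xE; apply: CE.
      have := component_connect (@edge_subpolygon_sym _ (T_ F) (~: T_ F :&: E)) XE dX xX.
      apply: connect_sub => k l /and3P[kE lE kl]; apply: connect1.
      move: kE lE; rewrite /edge /= !inE => /andP[-> kE] /andP[-> lE].
      rewrite (contraL (CE k)) // (contraL (CE l)) //=.
    apply: (plucker_trans nlx); first by apply: pC; apply: D0.
    exact: class0 EF xE iE.
  have SC k l : connect (edge (G_ F)) k l -> S k -> S l.
    move=> kl /orP[kC|/exists_inP[d dD dk]]; apply/orP.
      left; rewrite (component_eq GF_sym CF kC) inE kl andbT.
      by apply: (@connect_verts _ (G_ F) _ _ _ kl); apply: (subsetP CV).
    by right; apply/exists_inP; exists d => //; apply: connect_trans kl.
  pose F1 := F :|: [set [set i; j] | i in C, j in D].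
  (* Old edges never leave [S], and new edges have both ends in [S], so only pairs inside [S] become
     newly connected. *)
  have joined i k : connect (edge (graph_on (~: T_ F) F1)) i k ->
      S i && S k || connect (edge (G_ F)) i k.
    pose r := [pred l | S i && S l || connect (edge (G_ F)) i l].
    suff cl : closed (edge (graph_on (~: T_ F) F1)) r.
      by move/(closed_connect cl); rewrite !inE connect0 orbT => <-.
    apply: intro_closed; first exact/sym_connect_sym/edge_graph_on_sym.
    move=> k' l /and3P[/= k'V lV /andP[k'l /setUP[klF|]]]; rewrite !inE.
      have k'_l : connect (edge (G_ F)) k' l.
        by apply: connect1; rewrite /edge /= k'V lV k'l klF.
      case/orP=> [/andP[-> /(SC _ _ k'_l) -> //]|ik'].
      by rewrite (connect_trans ik' k'_l) orbT.
    case/imset2P=> c d cC dD klE.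
    have Scd z : z \in [set k'; l] -> S z.
      rewrite klE => /set2P[->|->]; first by rewrite /S cC.
      by apply/orP; right; apply/exists_inP; exists d.
    have [Sk' Sl] : S k' /\ S l by split; apply: Scd; rewrite !inE eqxx ?orbT.
    rewrite Sl andbT; case/orP=> [/andP[-> //]|ik'].
    by rewrite (SC k') // (sym_connect_sym GF_sym).
  have /no /(not_compl Mp)[B BF BM] : join_component F C D \in successors F.
    by apply/bigcupP; exists C => //; apply/setUP; left; apply/imsetP; exists D.
  have M0 i k : i != k -> B = [set i; k] -> p i k = 0%R -> False.
    by move=> ik BE ik0; move: BM; rewrite BE ME // -/p ik0 eqxx.
  (* A base in the join comes from [F], from [C] times [D], or from the closure; in each case its
     minor vanishes or [MF] is violated. *)
  case/setUP: BF => [/setUP[BF|/imset2P[c d cC dD BE]]|].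
  - by have /subsetP/(_ B BM) := MF; rewrite in_setD BF.
  - apply: M0 BE _; last first.
      by apply: (plucker_trans nlc0); [apply: class0 CF c0C cC|apply: D0].
    by apply: contraTneq (DV _ dD) => <-; rewrite in_setD cC.
  - case/imset2P=> i k iV; rewrite inE => /andP[_ /andP[ik /joined ikj]] BE.
    apply: M0 ik BE _; case/orP: ikj => [/andP[Si Sk]|]; last exact: conn0.
    by apply: (plucker_trans nlc0); apply: S0.
have [C CS] := set0Pn _ F_splitting.
have [CF CV] := C_in _ CS; rewrite /connected -ltnNge => /card_gt1P[D1 [D2 [D1C D2C D12]]].
have [d1 d1D nd1] := nonpar _ _ CS D1C; have [d2 d2D nd2] := nonpar _ _ CS D2C.
have nd : ~~ connect (edge (delete (P_ F) C)) d1 d2.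
  apply: contra D12 => cd; apply/eqP.
  rewrite (component_eq (D_sym C) D1C d1D) (component_eq (D_sym C) D2C d2D).
  by apply/setP=> z; rewrite !inE (same_connect (sym_connect_sym (D_sym C)) cd).
have d1V := subsetP (component_sub D1C) _ d1D.
have d2V := subsetP (component_sub D2C) _ d2D.
(* Both arcs between [x] and [y] meet [C], hence contain nonzero vectors [a], [b] of [C], which are
   parallel. *)
have sep (x y : 'I_n) : x \in ~: T_ F :\: C -> y \in ~: T_ F :\: C -> x < y ->
    ~~ connect (edge (delete (P_ F) C)) x y ->
    exists a, [/\ a \in C, nl a & p a x = 0%R \/ p a y = 0%R].
  move=> xV yV xy nxy.
  have [c cV [c' c'V /andP[cb c'b]]] := disconnect_separated (subsetDl _ _) xV yV xy nxy.
  have inC z : z \in ~: T_ F :\: (~: T_ F :\: C) -> z \in C.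
    by move/setDP=> [zV]; rewrite in_setD zV andbT negbK.
  have [a [aC nla ab]] := nl_between _ _ _ _ CS (inC _ cV) xV yV xy.
  have [b [bC nlb bb]] := nl_between _ _ _ _ CS (inC _ c'V) xV yV xy.
  exists a; split=> //; apply: (plucker_alternating (b := b) pos xy) => //.
  - by rewrite ab.
  - rewrite -bb in c'b.
    have bx : nat_of_ord b <> x by move/val_inj => e; move: xV; rewrite -e in_setD bC.
    have b_y : nat_of_ord b <> y by move/val_inj => e; move: yV; rewrite -e in_setD bC.
    exact: not_between.
  - exact: class0 CF aC bC.
have : d1 != d2 by apply: contraNneq nd => ->; apply: connect0.
rewrite neq_ltn => /orP[lt|lt].
  have [a [aC nla [z|z]]] := sep _ _ d1V d2V lt nd; [case: (nd1 _ aC nla z) | case: (nd2 _ aC nla z)].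
rewrite (sym_connect_sym (D_sym C)) in nd.
have [a [aC nla [z|z]]] := sep _ _ d2V d1V lt nd; [case: (nd2 _ aC nla z) | case: (nd1 _ aC nla z)].
Qed.
End Successor.

Lemma set2_pairs n (i j : 'I_n) : ([set i; j] \in pairs n) = (i != j).
Proof. by rewrite inE cards2; case: (i != j). Qed.

Lemma set2_compl n (F : {set {set 'I_n}}) i j :
  ([set i; j] \in compl F) = ([set i; j] \notin F) && (i != j).
Proof. by rewrite in_setD set2_pairs. Qed.

(** * Realising the complement of a set without splitting classes *)

Section Nonsplitting.
Variables (R : realType) (n : nat) (F : {set {set 'I_n}}).
Hypothesis F_closed : closed_pairs F.
Hypothesis nonsplitting : splitting F = set0.
Let V := ~: T_ F.
Let r := connect (edge (G_ F)).
Let r_sym i j : r i j = r j i := sym_connect_sym (@edge_graph_on_sym _ _ _) i j.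
Let r_trans i j k : r i j -> r j k -> r i k := @connect_trans _ _ _ _ _.

(** The polygon minus the class of [a] is connected, so the class members [a] and [b] cannot
    separate [x] from [y]. *)
Lemma class_noncrossing (a b x y : 'I_n) : a \in V -> r a b -> a < b ->
  x \in V -> y \in V -> ~~ r a x -> ~~ r a y -> (a < x < b) = (a < y < b).
Proof.
move=> aV ab lt xV yV ax ay.
have [C CF aC] := component_of (aV : a \in verts (G_ F)).
have CE z : (z \in C) = (z \in V) && r a z.
  by rewrite (component_eq (@edge_graph_on_sym _ _ _) CF aC) inE.
have bV : b \in V by apply: (@connect_verts _ (G_ F) _ _ aV ab).
have Cconn : connected (delete (P_ F) C).
  by move/setP/(_ C): nonsplitting; rewrite !inE CF => /negbFE.
apply: (@connect_between _ (T_ F) (V :\: C)) => //; first exact: subsetDl.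
- by rewrite !in_setD aC aV.
- by rewrite !in_setD CE bV ab.
- apply: (connected_connect (@edge_subpolygon_sym _ (T_ F) (V :\: C)) Cconn).
    by rewrite in_setD CE xV (negPf ax).
  by rewrite in_setD CE yV (negPf ay).
Qed.

(** The class minimum serves both as canonical representative and as slope of the realising
    vector. *)
Let m (i : 'I_n) : 'I_n := [arg min_(j < i | r i j) val j].

Lemma class_min_connect i : r i (m i).
Proof. by rewrite /m; case: arg_minnP => //; apply: connect0. Qed.

Lemma class_min_le i j : r i j -> m i <= j.
Proof. by rewrite /m; case: arg_minnP => [|k _ kmin]; [apply: connect0 | apply: kmin]. Qed.

Lemma class_min_eq i j : (m i == m j) = r i j.
Proof.
apply/eqP/idP => [e|ij].
  by apply: r_trans (class_min_connect i) _; rewrite e r_sym; apply: class_min_connect.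
apply: val_inj; apply/eqP; rewrite eqn_leq.
rewrite !class_min_le //; first by rewrite r_sym in ij; apply: r_trans ij (class_min_connect i).
exact: r_trans ij (class_min_connect j).
Qed.

(* True only on the final segment of the class that wraps around the end of the
   cyclic order. *)
Let wrapped i := [exists d in V, ~~ r i d && (m i < d < i)].

(** One outside element between [m i] and [i] forces all of them there, by noncrossing applied to
    these two class members. *)
Lemma wrapped_between i e : i \in V -> wrapped i -> e \in V -> ~~ r i e -> m i < e < i.
Proof.
move=> iV /exists_inP[d dV /andP[id mdi]] eV ie.
have mi : r (m i) i by rewrite r_sym; apply: class_min_connect.
have mV : m i \in V by apply: (@connect_verts _ (G_ F) _ _ iV); apply: class_min_connect.
have far z : ~~ r i z -> ~~ r (m i) z.
  by apply: contra; apply: r_trans; apply: class_min_connect.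
rewrite -(class_noncrossing mV mi _ dV eV (far _ id) (far _ ie)) //.
by case/andP: mdi; apply: ltn_trans.
Qed.

Lemma nonsplitting_positroid : positroid R (compl F).
Proof.
pose u i : R := if i \in V then ((-1) ^+ wrapped i)%R else 0%R.
pose v i : R := (u i * (m i)%:R)%R.
have uvE i j : plucker u v i j = (u i * u j * ((m j)%:R - (m i)%:R))%R.
  by rewrite /plucker /v; ring.
apply: (@plucker_positroid _ _ _ u v); first exact: subsetDl.
- move=> i j ij; rewrite set2_compl uvE => /andP[ijF ne].
  have [iV jV] : i \in V /\ j \in V.
    split; rewrite inE; apply: contra ijF; rewrite inE => /forallP.
      by move/(_ j); rewrite eq_sym ne.
    by move/(_ i); rewrite ne setUC.
  have rij : ~~ r i j by apply: contra ijF; apply: F_closed.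
  have rji : ~~ r j i by rewrite r_sym.
  have mij : nat_of_ord (m i) <> m j by move/val_inj/eqP; rewrite class_min_eq (negPf rij).
  have mi : m i <= i by apply/class_min_le/connect0.
  (* If [i] were wrapped, [j] would lie below [i]. *)
  rewrite /u iV jV; have [wi|_] := boolP (wrapped i).
    by have := wrapped_between iV wi jV rij; rewrite (ltnNge j) (ltnW ij) andbF.
  (* If [j] is wrapped, [m i] lies above [m j], and the sign of [u j] compensates. *)
  have [wj|wj] := boolP (wrapped j); rewrite /= expr0 mul1r.
    have miV : m i \in V by apply: (@connect_verts _ (G_ F) _ _ iV); apply: class_min_connect.
    have jmi : ~~ r j (m i).
      apply: contra rji => jm; apply: r_trans jm _.
      by rewrite r_sym; apply: class_min_connect.
    have /andP[lt _] := wrapped_between jV wj miV jmi.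
    by rewrite expr1 mulN1r opprB subr_gt0 ltr_nat.
  (* If [m j < m i], then [i] lies between [m j] and [j], so [j] would be wrapped. *)
  rewrite mul1r subr_gt0 ltr_nat ltn_neqAle; apply/andP; split; first exact/eqP.
  rewrite leqNgt; apply: contra wj => lt; apply/exists_inP; exists i => //.
  by rewrite rji ij andbT (leq_trans lt).
- move=> i j ij; rewrite set2_compl uvE negb_and negbK => /orP[ijF|]; last first.
    by rewrite negbK => /eqP ije; rewrite ije ltnn in ij.
  have [iV|iT] := boolP (i \in V); last by rewrite /u (negPf iT) !mul0r.
  have [jV|jT] := boolP (j \in V); last by rewrite /u (negPf jT) mulr0 !mul0r.
  have rij : r i j.
    apply: connect1; rewrite /edge /= iV jV ijF andbT.
    by apply: contraTneq ij => ->; rewrite ltnn.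
  by move: rij; rewrite -class_min_eq => /eqP->; rewrite subrr mulr0.
Qed.

End Nonsplitting.

(** * Transitivity of parallelism, initially and along the algorithm *)

(** Suppose [[set i; k]] and [[set k; l]] are non-bases but [[set i; l]] is a base. A base
    [[set k; w]] exists as [k] is no loop, and exchanging [w] into [[set i; l]] makes one of the two
    non-bases a base. *)
Lemma matroid_closed_pairs n (D : {set {set 'I_n}}) :
  matroid (compl D) -> closed_pairs D.
Proof.
case=> _ _ exch i j ij.
have [iV|iT] := boolP (i \in ~: T_ D); last first.
  by move: iT; rewrite !inE negbK => /forallP/(_ j); rewrite eq_sym ij.
pose a := [pred k | (k == i) || ([set i; k] \in D)].
suff cl : closed (edge (G_ D)) a.
  by move/(closed_connect cl); rewrite !inE eqxx eq_sym (negPf ij).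
apply: intro_closed; first exact/sym_connect_sym/edge_graph_on_sym.
move=> k l /and3P[/= kV lV /andP[kl klD]]; rewrite !inE.
have [<- _|ki /= ikD] := eqVneq k i; first by rewrite klD orbT.
have [//|li /=] := eqVneq l i; apply: contraT => ilD.
move: kV; rewrite !inE => /forallPn[w]; rewrite negb_imply => /andP[wk kwD].
have wil : w \notin [set i; l].
  by rewrite !inE negb_or; apply/andP; split; apply: contraNneq kwD => ->; rewrite // setUC.
have B1 : [set k; w] \in compl D by rewrite set2_compl kwD eq_sym.
have B2 : [set i; l] \in compl D by rewrite set2_compl ilD eq_sym.
have [|b] := exch _ _ B1 B2 w; first by rewrite in_setD wil !inE eqxx orbT.
have -> : [set k; w] :\ w = [set k].
  by apply/setP=> z; rewrite !inE; case: eqVneq => [->|_]; rewrite ?orbF // (negPf wk).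
rewrite in_setD => /andP[_ /set2P[->|->]]; rewrite set2_compl; first by rewrite ikD.
by rewrite setUC klD.
Qed.

Lemma T_mono n (F F' : {set {set 'I_n}}) : F \subset F' -> T_ F \subset T_ F'.
Proof.
move=> FF'; apply/subsetP=> i; rewrite !inE => /forallP iT; apply/forallP=> j.
by apply/implyP=> ji; apply: (subsetP FF'); apply: (implyP (iT j)).
Qed.

(** [T_] only grows, so each edge of the new graph joins vertices already connected in the graph of
    [F1], and the join contains all such pairs. *)
Lemma join_component_closed_pairs n (F : {set {set 'I_n}}) C D :
  closed_pairs (join_component F C D).
Proof.
move=> i j ij; set F' := join_component F C D.
pose F1 := F :|: [set [set i; j] | i in C, j in D].
have TF : ~: T_ F' \subset ~: T_ F.
  by rewrite setCS T_mono // /F' /join_component -setUA subsetUl.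
have sub : subrel (edge (G_ F')) (connect (edge (graph_on (~: T_ F) F1))).
  move=> k l /and3P[/= /(subsetP TF) kV /(subsetP TF) lV /andP[kl /setUP[klF|]]].
    by apply: connect1; rewrite /edge /= kV lV kl.
  case/imset2P=> k' l' _; rewrite inE => /andP[_ /andP[_ conn]] klE.
  have := set22 k l; have := set21 k l; rewrite klE => /set2P[ek|ek] /set2P[el|el].
  - by rewrite ek el eqxx in kl.
  - by rewrite ek el.
  - by rewrite ek el (sym_connect_sym (@edge_graph_on_sym _ _ _)).
  - by rewrite ek el eqxx in kl.
move=> conn; have iV : i \in ~: T_ F.
  case/connectP: conn => [[|k p] /=]; first by move=> _ e; rewrite e eqxx in ij.
  by case/andP=> /and3P[/(subsetP TF)].
have {}conn := connect_sub sub conn.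
have jV : j \in ~: T_ F by apply: (@connect_verts _ (graph_on (~: T_ F) F1) _ _ iV conn).
by apply/setUP; right; apply/imset2P; exists i j => //; rewrite inE jV ij.
Qed.

(** Elements of [X] become loops and leave the graph, so no added pair survives as an edge. *)
Lemma add_loops_closed_pairs n (F : {set {set 'I_n}}) X :
  closed_pairs F -> closed_pairs (add_loops F X).
Proof.
move=> F_closed i j ij conn; apply/setUP; left; apply: F_closed ij _.
apply: connect_sub conn => k l /and3P[/= kV lV /andP[kl klF]].
have notX z : z \in ~: T_ (add_loops F X) -> z \notin X.
  rewrite !inE; apply: contra => zX; apply/forallP=> w; apply/implyP=> wz.
  by apply/setUP; right; apply/imset2P; exists z w; rewrite ?inE.
have TF : ~: T_ (add_loops F X) \subset ~: T_ F by rewrite setCS T_mono // subsetUl.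
apply: connect1; rewrite /edge /= !(subsetP TF) // kl.
case/setUP: klF => // /imset2P[z w zX _ klE].
have := set21 z w; rewrite -klE => /set2P[] e; rewrite e in zX.
  by have := notX _ kV; rewrite zX.
by have := notX _ lV; rewrite zX.
Qed.

Lemma successors_closed_pairs n (F F' : {set {set 'I_n}}) :
  closed_pairs F -> F' \in successors F -> closed_pairs F'.
Proof.
move=> F_closed /bigcupP[C _ /setUP[]/imsetP[W _ ->]].
  exact: join_component_closed_pairs.
exact: add_loops_closed_pairs.
Qed.

(** * The invariant of the worklist *)

(** The clause [D \subset F] keeps [compl F] inside [compl D], where the maximality of [M]
    applies. *)
Lemma pass_invariant (R : realType) n (D M : {set {set 'I_n}}) k :
  matroid (compl D) -> MPos R D M ->
  M \in (iter k (@pass n) (init D)).2 \/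
  exists F, [/\ F \in (iter k (@pass n) (init D)).1, D \subset F, closed_pairs F
             & M \subset compl F].
Proof.
move=> D_matroid [M_pos MD M_max]; elim: k => [|k [MPos_k|[F [Fk DF F_closed MF]]]] /=.
- right; exists D; split=> //; first by rewrite inE.
  exact: matroid_closed_pairs.
- by left; rewrite inE MPos_k.
have [F0|F_split] := eqVneq (splitting F) set0.
  left; apply/setUP; right; apply/imsetP; exists F; first by rewrite inE Fk F0 eqxx.
  (* [compl F] is a positroid containing [M], so a strict inclusion would contradict maximality. *)
  apply/eqP; rewrite eqEsubset MF /=; apply: contraT => nMF; case: M_max.
  exists (compl F); split; first exact: nonsplitting_positroid.
    by rewrite properE MF.
  by apply: setDS.
have [F' F'F MF'] := positroid_successor F_closed M_pos MF F_split.
right; exists F'; split=> //.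
- by apply/bigcupP; exists F; rewrite // (negPf F_split).
- exact: subset_trans DF (proper_sub (successors_proper F'F)).
- exact: successors_closed_pairs F'F.
Qed.

Theorem proposition3p21 (R : realType) (n : nat) (hn : 2 <= n)
  (D : {set {set 'I_n}}) (hD : D \subset pairs n) (hDc : matroid (compl D)) :
  forall M : {set {set 'I_n}}, MPos R D M -> M \in Pos D.
Proof.
move=> M MD; rewrite /Pos; case: ex_minnP => k /eqP work0 _.
by have [//|[F []]] := pass_invariant k hDc MD; rewrite work0 inE.
Qed.
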